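(* For any $\delta > 0$ there exist a positive integer $n$ and a fractional assignment $x \in [0,1]^{3 \times n}$ such that for any assignment $y \in \{0,1\}^{3 \times n}$ satisfying $y_{ij} = 0$ whenever $x_{ij} = 0$, there exist some $i\in [3]$ and $t \in [n]$ for which \[ \Big|\sum_{j \in [t]} (x_{ij} - y_{ij}) \Big| \ge 1-\delta. \]
   Context: $[k] := \{1,\dots,k\}$. A matrix $x \in [0,1]^{m \times n}$ is a fractional assignment if $\sum_{i \in [m]} x_{ij} = 1$ for every column $j \in [n]$. A matrix $y \in \{0,1\}^{m \times n}$ is an (integral) assignment if $\sum_{i \in [m]} y_{ij} = 1$ for every $j \in [n]$. *)

(* Defs.v *)
From mathcomp Require Import all_boot all_order all_algebra.
From mathcomp Require Import reals.

Set Implicit Arguments.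
Unset Strict Implicit.
Unset Printing Implicit Defensive.

Import Order.TTheory GRing.Theory Num.Theory.

Local Open Scope ring_scope.

Definition fractional_assignment (R : realType) (m n : nat)
    (x : 'M[R]_(m, n)) : Prop :=
  (forall i j, 0 <= x i j <= 1) /\ (forall j, \sum_(i < m) x i j = 1).

(* The 0/1 entries are taken in R, so that x - y is a difference of real
   matrices. *)
Definition integral_assignment (R : realType) (m n : nat)
    (y : 'M[R]_(m, n)) : Prop :=
  (forall i j, y i j = 0 \/ y i j = 1) /\ (forall j, \sum_(i < m) y i j = 1).

(* Main.v *)
(* Write d for the vector of prefix sums of x - y, and a = 1/N <= delta. The
   columns alternate between (0, a, 1-a) and (a, 1-a, 0), N times each. From
   d = (ka, 0, -ka), giving a column (0, a, 1-a) to row 1 makes d_1 = a - 1, so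
   it goes to row 2; then d_1 = a, and giving the next column (a, 1-a, 0) to
   row 0 makes d_1 = 1, so it goes to row 1 and d = ((k+1)a, 0, -(k+1)a).
   Thus y is forced throughout, until d_2 = -Na = -1. *)
Require Import Defs.
From mathcomp Require Import all_boot all_order all_algebra.
From mathcomp Require Import reals.
From mathcomp Require Import zify ring lra.

Import Order.TTheory GRing.Theory Num.Theory.

Local Open Scope ring_scope.

(** Bridges the inclusive prefixes of the theorem and the strict prefixes of the induction, which
    can start from the empty one. *)
Lemma big_ord_le_recr (V : nmodType) (n : nat) (F : 'I_n -> V) (t : 'I_n) :
  \sum_(j < n | (j <= t)%N) F j = \sum_(j < n | (j < t)%N) F j + F t.
Proof.
rewrite (bigD1 t) //= addrC; congr (_ + _).
by apply: eq_bigl => j; rewrite ltn_neqAle andbC.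
Qed.

Lemma sum_ord3 (V : nmodType) (F : 'I_3 -> V) :
  \sum_i F i = F (inord 0) + F (inord 1) + F (inord 2).
Proof.
rewrite !big_ord_recr big_ord0 /= add0r.
by congr (F _ + F _ + F _); apply: val_inj; rewrite /= inordK.
Qed.

Definition drift_mx {R : realType} (a : R) (n : nat) : 'M[R]_(3, n) :=
  \matrix_(i < 3, j < n)
    nth 0 (if odd j then [:: a; 1 - a; 0] else [:: 0; a; 1 - a]) i.

Lemma drift_mx_fractional (R : realType) (a : R) (n : nat) :
  0 <= a <= 1 -> fractional_assignment (drift_mx a n).
Proof.
move=> /andP[a_ge0 a_le1]; split=> [i j|j].
  by rewrite mxE; case: odd; case: i => [[|[|[|//]]] ?] /=; lra.
by rewrite sum_ord3 !mxE !inordK //; case: odd => /=; ring.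
Qed.

(** Here [b] stands for [1 - delta]. Row 1 does the forcing: [b <= 1 - a] settles the even column of
    each pair and [b <= 1] the odd one. Row 0 is not tracked, as each column of x - y sums to 0. *)
Lemma drift_mx_forced (R : realType) (a b : R) (N : nat) (y : 'M[R]_(3, N.*2)) :
  b <= 1 - a -> b <= 1 ->
  integral_assignment y ->
  (forall i j, drift_mx a N.*2 i j = 0 -> y i j = 0) ->
  (forall i (t : 'I_N.*2),
     `|\sum_(j < N.*2 | (j <= t)%N) (drift_mx a N.*2 i j - y i j)| < b) ->
  forall k, (k <= N)%N ->
    \sum_(j < N.*2 | (j < k.*2)%N)
       (drift_mx a N.*2 (inord 1) j - y (inord 1) j) = 0 /\
    \sum_(j < N.*2 | (j < k.*2)%N)
       (drift_mx a N.*2 (inord 2) j - y (inord 2) j) = - (a *+ k).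
Proof.
move=> b_le b_le1 [y01 ysum] ysupp small; elim=> [|k IHk] k_lt.
  by rewrite !big_pred0_eq mulr0n oppr0.
have [S1 S2] := IHk (ltnW k_lt).
have lt0 : (k.*2 < N.*2)%N by lia.
have lt1 : (k.*2.+1 < N.*2)%N by lia.
pose t0 := Ordinal lt0; pose t1 := Ordinal lt1.
have t1E (F : 'I_N.*2 -> R) : \sum_(j < N.*2 | (j < t1)%N) F j =
    \sum_(j < N.*2 | (j < t0)%N) F j + F t0 by rewrite -big_ord_le_recr.
have doubleSE (F : 'I_N.*2 -> R) : \sum_(j < N.*2 | (j < k.+1.*2)%N) F j =
    \sum_(j < N.*2 | (j < t0)%N) F j + F t0 + F t1.
  by rewrite -t1E -big_ord_le_recr; apply: eq_bigl => j; rewrite doubleS.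
have small0 := small (inord 1) t0; have small1 := small (inord 1) t1.
rewrite big_ord_le_recr S1 mxE /= inordK // odd_double /= add0r in small0.
rewrite big_ord_le_recr t1E S1 !mxE /= inordK //= odd_double /= add0r in small1.
have y00 : y (inord 0) t0 = 0.
  by apply: ysupp; rewrite mxE /= odd_double inordK.
have y21 : y (inord 2) t1 = 0.
  by apply: ysupp; rewrite mxE /= odd_double inordK.
have := ysum t0; have := ysum t1; rewrite !sum_ord3 y00 y21 => sum1 sum0.
move: small0 small1; rewrite !ltr_norml => /andP[small0 _] /andP[_ small1].
have y10 : y (inord 1) t0 = 0.
  by case: (y01 (inord 1) t0) => // y10; move: small0; rewrite y10; lra.
have y11 : y (inord 1) t1 = 1.
  by case: (y01 (inord 1) t1) => // y11; move: small1; rewrite y10 y11; lra.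
(* By [sum0], row 2 takes column [t0], so over the pair its sum moves by [(1 - a) - 1 = - a], and
   that of row 1 by [a + (1 - a) - 1 = 0]. *)
rewrite !doubleSE S1 S2 !mxE /= !inordK //= odd_double /= y10 y11 y21 mulrSr.
by split; lra.
Qed.

(* Columns are numbered from 0, so the prefix [t] of the columns is
   {j : 'I_n | j <= t} with t : 'I_n. *)
Theorem proposition4 (R : realType) (delta : R) (hdelta : 0 < delta) :
  exists (n : nat) (x : 'M[R]_(3, n)),
    (0 < n)%N /\ fractional_assignment x /\
    forall y : 'M[R]_(3, n),
      integral_assignment y ->
      (forall i j, x i j = 0 -> y i j = 0) ->
      exists (i : 'I_3) (t : 'I_n),
        1 - delta <= `| \sum_(j < n | (j <= t)%N) (x i j - y i j) |.
Proof.
have [M ltM] : exists M : nat, delta^-1 < M%:R.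
  by exists (Num.bound delta^-1); rewrite archi_boundP // invr_ge0 ltW.
case: M ltM => [|M ltM]; first by rewrite ltNge invr_ge0 (ltW hdelta).
set a : R := M.+1%:R^-1.
have a_ge0 : 0 <= a by rewrite invr_ge0.
have a_le1 : a <= 1 by rewrite invf_le1 ?ltr0Sn // ler1n.
have a_le : a <= delta.
  by rewrite -[delta]invrK lef_pV2 ?posrE ?invr_gt0 ?ltr0Sn // ltW.
exists M.+1.*2, (drift_mx a _); split=> //; split.
  by apply: drift_mx_fractional; rewrite a_ge0.
move=> y yint ysupp.
(* Over finite index types the claim is a boolean, so its negation yields a strict bound on all
   prefixes at once. *)
suff /existsP[i /existsP[t le_it]] : [exists i : 'I_3, [exists t : 'I_M.+1.*2,
    1 - delta <=
    `|\sum_(j < M.+1.*2 | (j <= t)%N) (drift_mx a _ i j - y i j)|]].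
  by exists i, t.
apply: contraT => /existsPn none.
have small i (t : 'I_M.+1.*2) :
    `|\sum_(j < M.+1.*2 | (j <= t)%N) (drift_mx a _ i j - y i j)| < 1 - delta.
  by rewrite ltNge; move/existsPn: (none i); apply.
have [||_] := drift_mx_forced R a (1 - delta) _ y _ _ yint ysupp small _
  (leqnn M.+1); [lra | lra |].
(* After all [M.+1] pairs row 2 stands at -1, against the bound [1 - delta < 1] at the last
   column. *)
rewrite -mulr_natr mulVf ?pnatr_eq0 // => sumE.
have := small (inord 2) ord_max.
(* Both [j <= ord_max] and [j < M.+1.*2] hold of every column. *)
rewrite (eq_bigl (fun j : 'I_M.+1.*2 => (j < M.+1.*2)%N)).
  by rewrite sumE normrN1; lra.
by move=> j; rewrite ltn_ord -ltnS ltn_ord.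
Qed.
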